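(* Let $t$ be an odd prime and let $n\geq 0$ be an integer such that $8n+1$ is a quadratic nonresidue modulo $t$. Then for every $0\leq i\leq t-1$, \[ \hat{N}_{t-1}(i,t,n)=\frac{\hat{p}_{t-1}(n)}{t}. \] In particular, $\hat{p}_{t-1}(n)\equiv 0\pmod t$.
   Context: A pod is a partition in which the odd parts are distinct (even parts may repeat); its generating function is $\prod_{k\ge1}(1+q^{2k-1})/(1-q^{2k})$. For a pod $\pi$, $\ell(\pi)$ denotes its total number of parts (odd and even). A $(t-1)$-colored pod of $n$ is a tuple $\overrightarrow{\pi}=(\pi_1,\dots,\pi_{t-1})$ of pods whose parts sum in total to $n$; $\hat{p}_{t-1}(n)$ denotes the number of such tuples. The multirank of such a tuple (with $t-1$ even) is \[ \overline{r}(\overrightarrow{\pi})=\sum_{k=1}^{(t-1)/2} k\bigl(\ell(\pi_k)-\ell(\pi_{t-k})\bigr), \] and $\hat{N}_{t-1}(i,t,n)$ denotes the number of $(t-1)$-colored pods of $n$ whose multirank $\overline{r}$ is congruent to $i$ modulo $t$. *)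

(* Defs.v *)
From mathcomp Require Import all_boot all_order all_algebra.
Set Implicit Arguments. Unset Strict Implicit. Unset Printing Implicit Defensive.
Import Order.TTheory GRing.Theory Num.Theory.

(* A partition with all parts <= n is encoded by its multiplicity function:
   m k = number of parts equal to k.+1 (for k < n).  Every partition of a
   number <= n has parts <= n and multiplicities <= n, so this encoding is a
   bijection onto partitions of size <= n. *)
Definition mult (n : nat) := {ffun 'I_n -> 'I_n.+1}.

Definition pod_size n (m : mult n) : nat := \sum_(k < n) k.+1 * m k.
Definition pod_len n (m : mult n) : nat := \sum_(k < n) (m k : nat).
Definition is_pod n (m : mult n) : bool :=
  [forall k : 'I_n, odd k.+1 ==> (m k <= 1)].

(* (r)-colored pods of n: tuples (pi_1,...,pi_r) of pods (component j-1 of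
   the finite function is pi_j) with total size n. *)
Definition colored_pod r n (c : {ffun 'I_r -> mult n}) : bool :=
  [forall j, is_pod (c j)] && (\sum_(j < r) pod_size (c j) == n).

Definition phat r n : nat := #|[pred c : {ffun 'I_r -> mult n} | colored_pod c]|.

(* ell(pi_j) for 1 <= j <= r (0 outside that range, never used) *)
Definition lenc r n (c : {ffun 'I_r -> mult n}) (j : nat) : nat :=
  oapp (fun i : 'I_r => pod_len (c i)) 0%N (insub j.-1).

Definition multirank r n (c : {ffun 'I_r -> mult n}) : int :=
  (\sum_(1 <= k < (r./2).+1)
     (Posz k * (Posz (lenc c k) - Posz (lenc c (r.+1 - k)))))%R.

Definition Nhat r (i t n : nat) : nat :=
  #|[pred c : {ffun 'I_r -> mult n} |
       colored_pod c && ((multirank c %% Posz t)%Z == Posz i)]|.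

Definition qnr (a t : nat) : bool :=
  ~~ [exists x : 'I_t, (x * x) %% t == a %% t].

(* Main.v *)
Require Import Defs.
From mathcomp Require Import all_boot all_order all_algebra.
From mathcomp Require Import all_field.
From mathcomp Require Import zify ring.
Set Implicit Arguments. Unset Strict Implicit. Unset Printing Implicit Defensive.
Import Order.TTheory GRing.Theory Num.Theory.

(** Let z be a primitive t-th root of unity.  Modulo t the multirank is
    sum_j j * len(pi_j), so sum_c z^(multirank c) q^|c| is the product of
    prod_k (1 + z^j q^(2k-1)) / (1 - z^j q^(2k)) over 1 <= j <= t - 1.
    Supplying the factor j = 0 turns it into a series in q^t, divided by
    prod_k (1 + q^(2k-1)) / (1 - q^(2k)); by Gauss the inverse of the latter is
    psi(-q) = sum_s (-q)^(s(s+1)/2).  As 8 s(s+1)/2 + 1 = (2s+1)^2, the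
    coefficient of q^n vanishes when 8n + 1 is not a square mod t, and
    Fourier inversion on Z/t gives the equidistribution.  All series are
    polynomials modulo X^(n+1); Gauss's identity comes from Shanks' finite
    version of it. *)

(** * Triangular numbers and Shanks' finite identity *)

Lemma triangular_square s : 8 * 'C(s.+1, 2) + 1 = s.*2.+1 * s.*2.+1.
Proof. by elim: s => // s IHs; rewrite binS bin1; lia. Qed.

Lemma bin2_double_succ N : 'C(N.*2.+1, 2) = N * N.*2.+1.
Proof. by have := triangular_square N.*2; lia. Qed.

Section ShanksIdentity.
Local Open Scope ring_scope.

Variables (R : comNzRingType) (x : R).

Definition oddprod m := \prod_(0 <= i < m) (1 - x ^+ i.*2.+1).
(** In Pochhammer notation [oddprod m] is (x; x^2)_m, and [evenprod m N] is (x^2; x^2)_N / (x^2;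
    x^2)_m written without division. *)
Definition evenprod m N := \prod_(m <= i < N) (1 - x ^+ i.+1.*2).

(** The bracket measures the change of the s-th summand of Shanks' sum from N to N + 1, less the new
    factor 1 - x^(2N+1) of [oddprod] applied to the old summand. These changes telescope. *)
Lemma shanks_telescope N m : (m <= N)%N ->
  \sum_(0 <= s < m.+1) x ^+ (s * N.*2.+1) * oddprod s * evenprod s N *
     (x ^+ s.*2 * (1 - x ^+ N.+1.*2) - (1 - x ^+ N.*2.+1)) =
  x ^+ (m.+1 * N.*2.+1) * oddprod m.+1 * evenprod m N.
Proof.
elim: m => [|m IHm] lemN.
  rewrite big_nat1 /oddprod big_geq // big_nat1 mul0n mul1n /=.
  by rewrite doubleS (exprS _ N.*2.+1); ring.
rewrite big_nat_recr //= IHm ?(ltnW lemN) //.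
have -> : evenprod m N = (1 - x ^+ m.+1.*2) * evenprod m.+1 N.
  by rewrite /evenprod big_ltn.
rewrite [oddprod m.+2]/oddprod big_nat_recr //= -/(oddprod _).
rewrite doubleS (exprS _ N.*2.+1) (mulSn m.+1) exprD (exprS _ m.+1.*2).
ring.
Qed.

Lemma shanks_identity N :
  oddprod N * \sum_(0 <= s < N.*2) x ^+ 'C(s.+1, 2) =
  \sum_(0 <= s < N) x ^+ (s * N.*2.+1) * oddprod s * evenprod s N.
Proof.
elim: N => [|N IHN]; first by rewrite !big_geq // mulr0.
(* S is the sum for N with the extra summand s = N, which supplies the triangular exponent N(2N+1).
   The telescoped sum at m = N supplies the next one, (N+1)(2N+1). *)
pose S := \sum_(0 <= s < N.+1) x ^+ (s * N.*2.+1) * oddprod s * evenprod s N.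
have ES : S = oddprod N * \sum_(0 <= s < N.*2.+1) x ^+ 'C(s.+1, 2).
  rewrite /S !big_nat_recr //= mulrDr IHN bin2_double_succ.
  by rewrite [evenprod N N]big_geq // mulr1 (mulrC (oddprod N)).
have ET := shanks_telescope (leqnn N).
rewrite [evenprod N N]big_geq // mulr1 in ET.
rewrite doubleS big_nat_recr //= mulrDr.
have -> : 'C(N.*2.+2, 2) = (N.+1 * N.*2.+1)%N.
  by rewrite binS bin1 bin2_double_succ mulSn addnC.
rewrite [X in _ + X]mulrC -ET [oddprod N.+1]/oddprod big_nat_recr //=.
rewrite -/(oddprod _) mulrAC -ES /S mulr_suml -big_split /=.
rewrite !big_nat; apply: eq_bigr => s /andP[_ lesN].
have -> : evenprod s N.+1 = evenprod s N * (1 - x ^+ N.+1.*2).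
  by rewrite /evenprod big_nat_recr.
have -> : (s * N.+1.*2.+1 = s * N.*2.+1 + s.*2)%N by lia.
by rewrite exprD; ring.
Qed.

End ShanksIdentity.

(** * Congruence of polynomials modulo X^m *)

Section TruncatedCongruence.
Local Open Scope ring_scope.

Variables (F : fieldType) (m : nat).
Implicit Types p q r : {poly F}.

Definition eqmodX p q := 'X^m %| p - q.

Lemma eqmodX_refl p : eqmodX p p.
Proof. by rewrite /eqmodX subrr dvdp0. Qed.

Lemma eqmodX_sym p q : eqmodX p q -> eqmodX q p.
Proof. by rewrite /eqmodX -opprB dvdpNr. Qed.

Lemma eqmodX_trans p q r : eqmodX p q -> eqmodX q r -> eqmodX p r.
Proof. by rewrite /eqmodX => pq qr; rewrite -(subrKA q) dvdp_add. Qed.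

Lemma eqmodX_mul p q p' q' :
  eqmodX p q -> eqmodX p' q' -> eqmodX (p * p') (q * q').
Proof.
rewrite /eqmodX => pq pq'.
have -> : p * p' - q * q' = p * (p' - q') + (p - q) * q' by ring.
by apply: dvdp_add; [apply: dvdp_mull | apply: dvdp_mulr].
Qed.

Lemma eqmodX_prod (I : Type) (s : seq I) (P : pred I) (f g : I -> {poly F}) :
  (forall i, P i -> eqmodX (f i) (g i)) ->
  eqmodX (\prod_(i <- s | P i) f i) (\prod_(i <- s | P i) g i).
Proof.
move=> fg; apply: (big_ind2 eqmodX) => //; first exact: eqmodX_refl.
by move=> *; apply: eqmodX_mul.
Qed.

(** A polynomial with nonzero constant term is coprime to X^m; this replaces division of power
    series. *)
Lemma eqmodX_cancel p q r :
  r.[0] != 0 -> eqmodX (p * r) (q * r) -> eqmodX p q.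
Proof.
rewrite /eqmodX -mulrBl => r0; rewrite Gauss_dvdpl //.
by rewrite coprimep_expl // coprimep_sym coprimepX rootE.
Qed.

Lemma eqmodX_coef p q i : eqmodX p q -> (i < m)%N -> p`_i = q`_i.
Proof.
move=> /dvdpP[r] /(canRL (subrK _)) -> im.
by rewrite coefD coefMXn im add0r.
Qed.

End TruncatedCongruence.

(** * Products and sums over the t-th roots of unity *)

Section RootsOfUnity.
Local Open Scope ring_scope.

Variables (F : fieldType) (t : nat) (z : F).
Hypothesis prim_z : t.-primitive_root z.

Lemma prod_1sub_prim_root (y : {poly F}) :
  \prod_(0 <= i < t) (1 - (z ^+ i)%:P * y) = 1 - y ^+ t.
Proof.
have t_gt0 := prim_order_gt0 prim_z.
have z0 : z != 0 by rewrite (prim_root_eq0 prim_z) -lt0n.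
(* The root of 1 - z^i X is z^-i, so X^t - 1 is factored along the powers of z^-1. *)
have prim_w : t.-primitive_root z^-1.
  have -> : z^-1 = z ^+ t.-1.
    by apply: (mulfI z0); rewrite divff // -exprS prednK ?prim_expr_order.
  by rewrite (prim_root_exp_coprime _ prim_z) coprimePn.
suff E : \prod_(0 <= i < t) (1 - (z ^+ i)%:P * 'X) = 1 - 'X^t.
  transitivity ((1 - 'X^t) \Po y).
    rewrite -E rmorph_prod; apply: eq_bigr => i _.
    by rewrite rmorphB rmorph1 rmorphM /= comp_polyC comp_polyX.
  by rewrite rmorphB rmorph1 /= comp_Xn_poly.
(* c collects the leading coefficients; evaluation at 0 then gives c = -1. *)
pose c : F := \prod_(0 <= i < t) - (z ^+ i).
have E : \prod_(0 <= i < t) (1 - (z ^+ i)%:P * 'X) = c%:P * ('X^t - 1).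
  rewrite -(factor_Xn_sub_1 prim_w) rmorph_prod -big_split /=.
  apply: eq_bigr => i _; rewrite mulrBr -polyCM mulNr -exprMn divff //.
  by rewrite expr1n !polyCN polyC1; ring.
have /(congr1 (horner^~ 0)) := E.
rewrite horner_prod big1 => [|i _]; last by rewrite !hornerE subr0.
rewrite !hornerE expr0n eqn0Ngt t_gt0 /= sub0r mulrN1 => c1.
by rewrite E -[c]opprK -c1 polyCN polyC1; ring.
Qed.

Lemma prod_1add_prim_root (y : {poly F}) : odd t ->
  \prod_(0 <= i < t) (1 + (z ^+ i)%:P * y) = 1 + y ^+ t.
Proof.
move=> oddt; have := prod_1sub_prim_root (- y).
rewrite exprNn -signr_odd oddt expr1 mulN1r opprK => <-.
by apply: eq_bigr => i _; rewrite mulrN opprK.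
Qed.

Lemma sum_prim_root_powers (m : nat) :
  \sum_(a < t) z ^+ (a * m) = if (t %| m)%N then t%:R else 0.
Proof.
have -> : \sum_(a < t) z ^+ (a * m) = \sum_(a < t) (z ^+ m) ^+ a.
  by apply: eq_bigr => a _; rewrite mulnC exprM.
rewrite (prim_order_dvd prim_z); case: eqP => [->|/eqP zm1].
  under eq_bigr do rewrite expr1n.
  by rewrite sumr_const card_ord.
apply/eqP; have := subrX1 (z ^+ m) t.
rewrite exprAC (prim_expr_order prim_z) expr1n subrr => /esym/eqP.
by rewrite mulf_eq0 subr_eq0 (negPf zm1).
Qed.

End RootsOfUnity.

(** * Truncated pod products and Gauss's identity *)

Section GaussIdentity.
Local Open Scope ring_scope.

Variables (F : fieldType) (n : nat).
Hypothesis n_gt0 : (0 < n)%N.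
Implicit Type y : {poly F}.

(** Contribution of the part k + 1, with multiplicities capped at n as in [mult n]. Modulo X^(n+1)
    it is the fraction [podnum] / [podden] when X divides y. *)
Definition podfactor k y : {poly F} :=
  \sum_(m < n.+1 | odd k.+1 ==> (m <= 1)%N) y ^+ m.
Definition podnum k y : {poly F} := if odd k.+1 then 1 + y else 1.
Definition podden k y : {poly F} := if odd k.+1 then 1 else 1 - y.

Lemma podfactor_den k y : 'X %| y ->
  eqmodX n.+1 (podfactor k y * podden k y) (podnum k y).
Proof.
move=> Xy; rewrite /podfactor /podden /podnum.
case: (boolP (odd k.+1)) => _ /=.
  (* Since n > 0, the range m <= n contains both multiplicities 0 and 1. *)
  rewrite mulr1 big_mkcond -(prednK n_gt0) !big_ord_recl /= big1 // addr0.
  by rewrite expr0 expr1 eqmodX_refl.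
have -> : (\sum_(m < n.+1) y ^+ m) * (1 - y) = 1 - y ^+ n.+1.
  by rewrite mulrC -opprB mulNr -subrX1 opprB.
by rewrite /eqmodX addrC addrA addNr sub0r dvdpNr dvdp_exp2r.
Qed.

Lemma podden_horner0 k y : 'X %| y -> (podden k y).[0] != 0.
Proof.
move=> /dvdpP[q ->]; rewrite /podden.
case: ifP => _; rewrite !hornerE ?oner_eq0 //.
by rewrite subr0 oner_eq0.
Qed.

(** After clearing denominators, numerator and denominator at y^t each split over the roots of
    unity. Oddness of t keeps the sign in 1 + y^t. *)
Lemma prod_podfactor_prim_root t (z : F) k y :
  odd t -> t.-primitive_root z -> 'X %| y ->
  eqmodX n.+1 (\prod_(0 <= i < t) podfactor k ((z ^+ i)%:P * y))
              (podfactor k (y ^+ t)).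
Proof.
move=> oddt prim_z Xy; have t_gt0 := prim_order_gt0 prim_z.
have Xyt : 'X %| y ^+ t by rewrite -(prednK t_gt0) exprS dvdp_mulr.
apply: (eqmodX_cancel (podden_horner0 k Xyt)).
apply: eqmodX_trans (eqmodX_sym (podfactor_den k Xyt)).
have -> : podden k (y ^+ t) = \prod_(0 <= i < t) podden k ((z ^+ i)%:P * y).
  rewrite /podden; case: ifP => _; first by rewrite big1.
  by rewrite prod_1sub_prim_root.
have -> : podnum k (y ^+ t) = \prod_(0 <= i < t) podnum k ((z ^+ i)%:P * y).
  rewrite /podnum; case: ifP => _; last by rewrite big1.
  by rewrite prod_1add_prim_root.
rewrite -big_split /=; apply: eqmodX_prod => i _.
by apply: podfactor_den; rewrite dvdp_mull.
Qed.

Definition triangular_series : {poly F} :=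
  \sum_(0 <= s < n.*2) (- 'X) ^+ 'C(s.+1, 2).

(** Putting x = -X changes the sign of the odd powers only, turning 1 - x^(2i+1) into 1 +
    X^(2i+1). *)
Lemma prod_podnum_oddprod N :
  \prod_(0 <= k < N.*2) podnum k 'X^(k.+1) = oddprod (- 'X) N.
Proof.
elim: N => [|N IHN]; first by rewrite /oddprod !big_geq.
rewrite doubleS 2?big_nat_recr //= IHN /oddprod big_nat_recr //=.
rewrite /podnum /= odd_double /= mulr1 [in RHS]exprNn -signr_odd /= odd_double.
by rewrite expr1 mulN1r opprK.
Qed.

Lemma prod_podden_evenprod N :
  \prod_(0 <= k < N.*2) podden k 'X^(k.+1) = evenprod (- 'X) 0 N.
Proof.
elim: N => [|N IHN]; first by rewrite /evenprod !big_geq.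
rewrite doubleS 2?big_nat_recr //= IHN /evenprod big_nat_recr //=.
rewrite /podden /= odd_double /= mulr1 [in RHS]exprNn -signr_odd /= odd_double.
by rewrite expr0 mul1r.
Qed.

(** Shanks' identity at N = n involves parts up to 2n; those above n are invisible modulo
    X^(n+1). *)
Lemma prod_eqmodX_widen (f : nat -> {poly F}) N : (n <= N)%N ->
  (forall k, (n <= k)%N -> eqmodX n.+1 (f k) 1) ->
  eqmodX n.+1 (\prod_(0 <= k < n) f k) (\prod_(0 <= k < N) f k).
Proof.
move=> leN f1; rewrite (big_cat_nat (n := n) _ leN) //= -[X in eqmodX _ X _]mulr1.
apply: eqmodX_mul; first exact: eqmodX_refl.
apply: eqmodX_sym; rewrite big_nat.
apply: (big_ind (fun p => eqmodX n.+1 p 1)); first exact: eqmodX_refl.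
  by move=> p q p1 q1; rewrite -[X in eqmodX _ _ X]mulr1; apply: eqmodX_mul.
by move=> k /andP[nk _]; apply: f1.
Qed.

Lemma gauss_identity_trunc :
  eqmodX n.+1 ((\prod_(0 <= k < n) podnum k 'X^(k.+1)) * triangular_series)
              (\prod_(0 <= k < n) podden k 'X^(k.+1)).
Proof.
have dvdX k : (n <= k)%N -> ('X^(n.+1) : {poly F}) %| 'X^(k.+1).
  by move=> nk; apply: dvdp_exp2l.
have len : (n <= n.*2)%N by rewrite -addnn leq_addr.
have num1 k : (n <= k)%N -> eqmodX n.+1 (podnum k 'X^(k.+1)) 1.
  move=> nk; rewrite /podnum; case: ifP => _; last exact: eqmodX_refl.
  by rewrite /eqmodX addrC addKr dvdX.
have den1 k : (n <= k)%N -> eqmodX n.+1 (podden k 'X^(k.+1)) 1.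
  move=> nk; rewrite /podden; case: ifP => _; first exact: eqmodX_refl.
  by rewrite /eqmodX addrC addKr dvdpNr dvdX.
apply: eqmodX_trans (eqmodX_sym (prod_eqmodX_widen len den1)).
apply: eqmodX_trans (eqmodX_mul (prod_eqmodX_widen len num1) (eqmodX_refl _ _)) _.
rewrite prod_podnum_oddprod prod_podden_evenprod shanks_identity.
rewrite big_ltn // mul0n expr0 mul1r {1}/oddprod big_geq // mul1r.
rewrite /eqmodX addrC addKr big_nat.
apply: (big_ind (fun p => 'X^(n.+1) %| p)); first exact: dvdp0.
  by move=> p q; apply: dvdp_add.
(* For s >= 1 the summand contains X^(s(2n+1)), and s(2n+1) >= n + 1; only s = 0 survives. *)
move=> s /andP[s_gt0 _]; rewrite -mulrA dvdp_mulr // exprNn dvdp_mull //.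
by rewrite dvdp_exp2l // -addnn; nia.
Qed.

Lemma prod_podfactor_triangular :
  eqmodX n.+1 ((\prod_(0 <= k < n) podfactor k 'X^(k.+1)) * triangular_series) 1.
Proof.
have Xk k : ('X : {poly F}) %| 'X^(k.+1) by rewrite exprS dvdp_mulr.
pose D : {poly F} := \prod_(0 <= k < n) podden k 'X^(k.+1).
have D0 : D.[0] != 0.
  by rewrite horner_prod prodf_seq_neq0; apply/allP => k _; apply: podden_horner0.
apply: (eqmodX_cancel D0); rewrite mul1r mulrAC.
apply: eqmodX_trans gauss_identity_trunc.
apply: eqmodX_mul; last exact: eqmodX_refl.
by rewrite -big_split; apply: eqmodX_prod => k _; apply: podfactor_den.
Qed.

End GaussIdentity.

(** A natural-number stand-in for the multirank modulo t, usable as an exponent of z: the weight -k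
    of color t - k becomes t - k. *)
Definition pod_rank r n (c : {ffun 'I_r -> mult n}) : nat :=
  \sum_(j < r) j.+1 * pod_len (c j).

(** * The generating function of colored pods at a root of unity *)

Section GeneratingFunction.
Local Open Scope ring_scope.

Variables (F : fieldType) (n : nat).

Lemma prod_podfactor_expand (a : F) :
  \prod_(k < n) podfactor n k (a%:P * 'X^(k.+1)) =
  \sum_(m : mult n | is_pod m) (a ^+ pod_len m)%:P * 'X^(pod_size m).
Proof.
rewrite /podfactor bigA_distr_big_dep.
apply: eq_big => [m | m _].
  by apply/familyP/forallP => h k; have := h k.
rewrite /pod_len /pod_size -!prodrXr rmorph_prod -big_split /=.
by apply: eq_bigr => k _; rewrite exprMn -rmorphXn -exprM.
Qed.

Lemma coef_colored_pod r (z : F) :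
  (\prod_(j < r) \prod_(k < n) podfactor n k ((z ^+ j.+1)%:P * 'X^(k.+1)))`_n =
  \sum_(c : {ffun 'I_r -> mult n} | colored_pod c) z ^+ pod_rank c.
Proof.
under eq_bigr do rewrite prod_podfactor_expand.
rewrite bigA_distr_big coef_sum [RHS]big_mkcond [LHS]big_mkcond /=.
apply: eq_bigr => c _; rewrite /colored_pod.
have -> : (c \in ffun_on (@is_pod n)) = [forall j, is_pod (c j)].
  by apply/ffun_onP/forallP => h j; have := h j.
case: [forall j, _] => //=.
rewrite big_split /= prodrXr -rmorph_prod coefCM coefXn eq_sym.
case: eqP => _; rewrite ?mulr0 // mulr1 /pod_rank -prodrXr.
by apply: eq_bigr => j _; rewrite exprM.
Qed.

Lemma coef_triangular_series i :
  (triangular_series F n)`_i != 0 -> exists s, i = 'C(s.+1, 2).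
Proof.
move=> h.
suff /hasP[s _ /eqP] : has (fun s => i == 'C(s.+1, 2)) (index_iota 0 n.*2).
  by exists s.
apply: contraR h => /hasPn h.
rewrite coef_sum big_seq big1 ?eqxx // => s /h /negPf si; rewrite exprNn.
have -> : (-1) ^+ 'C(s.+1, 2) = ((-1) ^+ 'C(s.+1, 2))%:P :> {poly F}.
  by rewrite rmorph_sign.
by rewrite coefCM coefXn si mulr0.
Qed.

Lemma sum_prim_root_pod_rank t (z : F) :
  odd t -> t.-primitive_root z -> qnr (8 * n + 1) t ->
  \sum_(c : {ffun 'I_(t - 1) -> mult n} | colored_pod c) z ^+ pod_rank c = 0.
Proof.
move=> oddt prim_z /existsPn nsq; have t_gt0 := prim_order_gt0 prim_z.
have nsqr s : (8 * n + 1 != s * s %[mod t])%N.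
  have := nsq (Ordinal (ltn_pmod s t_gt0)).
  by rewrite /= modnMml modnMmr eq_sym.
have n_gt0 : (0 < n)%N by case: (posnP n) nsqr => // -> /(_ 1%N)/eqP.
rewrite -coef_colored_pod.
pose A i : {poly F} :=
  \prod_(0 <= k < n) podfactor n k ((z ^+ i)%:P * 'X^(k.+1)).
have -> : \prod_(j < t - 1) \prod_(k < n)
    podfactor n k ((z ^+ j.+1)%:P * 'X^(k.+1)) = \prod_(1 <= i < t) A i.
  rewrite big_add1 -subn1 big_mkord; apply: eq_bigr => j _.
  by rewrite /A big_mkord.
set G := \prod_(1 <= i < t) A i.
pose B : {poly F} := \prod_(0 <= k < n) podfactor n k 'X^(k.+1).
have Xk k : ('X : {poly F}) %| 'X^(k.+1) by rewrite exprS dvdp_mulr.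
(* With the missing color 0 supplied, the product runs over all t-th roots of unity and becomes a
   polynomial in X^t. *)
have GA : eqmodX n.+1 (A 0%N * G) (B \Po 'X^t).
  rewrite -[A 0%N * G]big_ltn // /A exchange_big /= rmorph_prod /=.
  apply: eqmodX_prod => k _.
  have -> : podfactor n k 'X^(k.+1) \Po 'X^t =
      podfactor n k ('X^(k.+1) ^+ t) :> {poly F}.
    rewrite rmorph_sum; apply: eq_bigr => m _.
    by rewrite rmorphXn /= comp_Xn_poly; congr (_ ^+ _); rewrite exprAC.
  exact: prod_podfactor_prim_root.
have AT := prod_podfactor_triangular F n_gt0.
have A0 : A 0%N = B by apply: eq_bigr => k _; rewrite expr0 mul1r.
(* The triangular series is the inverse of the color 0 factor, so multiplying by it removes that
   factor. *)
have GT : eqmodX n.+1 G ((B \Po 'X^t) * triangular_series F n).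
  apply: eqmodX_trans (eqmodX_mul GA (eqmodX_refl _ _)).
  rewrite A0 mulrAC -[X in eqmodX _ X _]mul1r.
  by apply: eqmodX_mul; [apply: eqmodX_sym | apply: eqmodX_refl].
rewrite (eqmodX_coef GT) // coefM big1 // => i _.
rewrite coef_comp_poly_Xn //; case: ifP => [/dvdnP[d Ei]|]; last by rewrite mul0r.
have [->|/coef_triangular_series[s Es]] :=
  eqVneq (triangular_series F n)`_(n - i) 0.
  by rewrite mulr0.
(* A nonzero term has i = d t and n - i triangular, so 8(n - i) + 1 is a square congruent to 8n + 1
   modulo t. *)
case/eqP: (nsqr s.*2.+1); rewrite -triangular_square -Es.
have -> : (8 * n + 1 = (8 * d) * t + (8 * (n - i) + 1))%N.
  by have := ltn_ord i; lia.
by rewrite modnMDl.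
Qed.

End GeneratingFunction.

(** * Multirank modulo t and Fourier inversion *)

Section Equidistribution.
Local Open Scope ring_scope.

Lemma multirank_mod t n (c : {ffun 'I_(t - 1) -> mult n}) : odd t ->
  (multirank c = (pod_rank c)%:Z %[mod t])%Z.
Proof.
move=> oddt; pose h := (t - 1)./2.
have Et : (t = h.*2.+1)%N by rewrite /h; lia.
have lenE : pod_rank c = (\sum_(1 <= j < t) j * lenc c j)%N.
  rewrite big_add1 -subn1 big_mkord; apply: eq_bigr => j _.
  by rewrite /lenc /= insubT // => lt_j;
    congr (_ * pod_len (c _))%N; apply: val_inj.
(* Colors k and t - k are paired, as in the multirank. *)
have splitE : (\sum_(1 <= j < t) j * lenc c j =
    \sum_(1 <= k < h.+1) (k * lenc c k + (t - k) * lenc c (t - k)))%N.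
  rewrite (@big_cat_nat _ _ _ h.+1) /=; try by lia.
  rewrite big_split /=; congr (_ + _)%N.
  rewrite big_nat_rev /= -[X in \sum_(X <= _ < _) _]add1n big_addn.
  have -> : (t - h = h.+1)%N by lia.
  rewrite !big_nat; apply: eq_bigr => k /andP[k1 kh].
  by have -> : (h.+1 + t - (k + h).+1 = t - k)%N by lia.
apply/eqP; rewrite eqz_mod_dvd lenE splitE /multirank -/h.
have -> : (t - 1).+1 = t by lia.
rewrite (big_morph Posz PoszD (erefl 0)) -sumrB big_nat.
apply: rpred_sum => k /andP[k1 kh].
(* The weights of color t - k are -k and t - k, which differ by -t. *)
apply/dvdzP; exists (- (lenc c (t - k))%:Z).
have Ek : Posz (t - k) = t%:Z - k%:Z by rewrite subzn //; lia.
by rewrite PoszD !PoszM Ek; ring.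
Qed.

Lemma equidistribution t n (i : nat) : prime t -> odd t ->
  qnr (8 * n + 1) t -> (i < t)%N -> (t * Nhat (t - 1) i t n = phat (t - 1) n)%N.
Proof.
move=> pt oddt hq lt_it; have t_gt0 := prime_gt0 pt.
have [z prim_z] := C_prim_root_exists t_gt0.
apply/eqP; rewrite -(eqr_nat algC) natrM; apply/eqP.
pose cp := @colored_pod (t - 1) n.
(* Orthogonality of characters detects the residue i; t - i replaces -i to keep the exponent
   natural. *)
have E (c : {ffun 'I_(t - 1) -> mult n}) :
    \sum_(a < t) z ^+ (a * (pod_rank c + (t - i))) =
    if ((multirank c %% t)%Z == i) then t%:R else 0 :> algC.
  rewrite (sum_prim_root_powers prim_z) multirank_mod // modz_nat eqz_nat.
  congr (if _ then _ else _).
  rewrite addnBA ?(ltnW lt_it) // -eqn_mod_dvd ?modnDr ?(modn_small lt_it) //.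
  by rewrite (leq_trans (ltnW lt_it)) ?leq_addl.
transitivity (\sum_(c | cp c) \sum_(a < t) z ^+ (a * (pod_rank c + (t - i)))).
  rewrite (eq_bigr _ (fun c _ => E c)) -big_mkcondr sumr_const mulr_natr.
  by congr (_ *+ _); apply: eq_card => c.
(* The frequency a = 0 counts all colored pods. For a != 0, z^a is again primitive because t is
   prime, so its sum vanishes. *)
rewrite exchange_big (bigD1 (Ordinal t_gt0)) //= [X in _ + X]big1 => [|a a0].
  by rewrite addr0 (eq_bigr (fun=> 1)) ?sumr_const.
have prim_za : t.-primitive_root (z ^+ a).
  rewrite (prim_root_exp_coprime _ prim_z) coprime_sym prime_coprime // gtnNdvd //.
  by rewrite lt0n.
under eq_bigr do rewrite mulnDr exprD exprM.
by rewrite -mulr_suml sum_prim_root_pod_rank ?mul0r.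
Qed.

End Equidistribution.

Theorem theorem2p4 (t n : nat) (ht : prime t) (hodd : odd t)
  (hq : qnr (8 * n + 1) t) :
  (forall i : nat, i <= t - 1 ->
     ((Nhat (t - 1) i t n)%:R = (phat (t - 1) n)%:R / t%:R :> rat)%R)
  /\ (t %| phat (t - 1) n).
Proof.
have t_gt0 := prime_gt0 ht.
split=> [i le_i|]; last first.
  by rewrite -(equidistribution ht hodd hq t_gt0) dvdn_mulr.
have lt_i : i < t by rewrite -[t]prednK // ltnS -subn1.
rewrite -(equidistribution ht hodd hq lt_i) natrM mulrC mulKf //.
by rewrite pnatr_eq0 -lt0n.
Qed.
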